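(* Let $\Gamma$ be a numerical monoid with Frobenius number $\mathcal{F}(\Gamma)$, let $s\in\mathbb{N}\setminus\Gamma$, and let $S_\Gamma^s$ be the associated Leamer monoid with set of atoms $\mathcal{A}(S_\Gamma^s)$. Let $x_0$ be the smallest $x$ with $(x,1)\in S_\Gamma^s$, and let $x_f$ be the smallest $x$ such that $(x,n)\in S_\Gamma^s$ for all $n\ge1$. Then: (a) If $(x,1)\in S_\Gamma^s$, then $(x,1)\in\mathcal{A}(S_\Gamma^s)$. (b) For all sufficiently large $n$, $(x_f,n)\in\mathcal{A}(S_\Gamma^s)$. (c) If $(x,n)\in S_\Gamma^s$, then $(x,n')\in S_\Gamma^s$ for all $1\le n'\le n$. (d) If $n>2$, $(x,n-1)\in\mathcal{A}(S_\Gamma^s)$ and $(x,n)\in S_\Gamma^s$, then $(x,n)\in\mathcal{A}(S_\Gamma^s)$. (e) If $n>2$, $(x,n-1)\in\mathcal{A}(S_\Gamma^s)$ and $(x-s,n)\in S_\Gamma^s$, then $(x-s,n)\in\mathcal{A}(S_\Gamma^s)$. (f) The column at every $x>\mathcal{F}(\Gamma)$ is infinite. (g) For all $x>\mathcal{F}(\Gamma)+x_0$ and $n\ge2$, $(x,n)$ is a reducible element of $S_\Gamma^s$.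
   Context: $\mathbb{N}$ contains $0$. A numerical monoid is an additive submonoid $\Gamma\subseteq\mathbb{N}$ (containing $0$) with finite complement; $\mathcal{F}(\Gamma)$ is the largest integer not in $\Gamma$. For $s\in\mathbb{N}\setminus\Gamma$ the Leamer monoid is $$S_\Gamma^s=\{(0,0)\}\cup\{(x,n): n\ge 1,\ \{x,x+s,x+2s,\ldots,x+ns\}\subset\Gamma\}\subset\mathbb{N}^2,$$ a monoid under componentwise addition. An atom (irreducible element) is a nonzero element that is not a sum of two nonzero elements of $S_\Gamma^s$; a nonzero non-atom is called reducible. The column at $x$ is the set $\{(x,n)\in S_\Gamma^s:n\ge1\}$; it is infinite if this set is infinite. Both $x_0$ and $x_f$ exist (there is an infinite column at $\mathcal{F}(\Gamma)+1$). *)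

(* Defs.v *)
From HB Require Import structures.
From mathcomp Require Import all_boot all_order all_algebra.
From mathcomp Require Import boolp classical_sets functions cardinality.

Set Implicit Arguments.
Unset Strict Implicit.
Unset Printing Implicit Defensive.

Import GRing.Theory.
Local Open Scope classical_set_scope.

Definition numerical_monoid (G : set nat) : Prop :=
  [/\ G 0, (forall a b, G a -> G b -> G (a + b)) & finite_set (~` G)].

Definition is_smallest (P : set nat) (m : nat) : Prop :=
  P m /\ forall k, P k -> m <= k.

Definition is_largest (P : set nat) (m : nat) : Prop :=
  P m /\ forall k, P k -> k <= m.

(* Natural-number-valued: the value -1 arises only for G = setT, which is
   excluded as soon as some s lies outside G. *)
Definition is_frobenius (G : set nat) (F : nat) : Prop :=
  is_largest (~` G) F.

Definition leamer (G : set nat) (s : nat) : set (nat * nat) :=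
  [set p | p = (0, 0) \/
           (1 <= p.2 /\ forall i, i <= p.2 -> G (p.1 + i * s))].

(* Atoms and reducible elements of a submonoid S of a commutative monoid M;
   for M = nat * nat the addition is componentwise and 0 is (0, 0). *)
Definition decomposable (M : nmodType) (S : set M) (p : M) : Prop :=
  exists a b, [/\ S a, S b, a <> 0%R, b <> 0%R & p = (a + b)%R].

Definition atoms (M : nmodType) (S : set M) : set M :=
  [set p | [/\ S p, p <> 0%R & ~ decomposable S p]].

Definition reducibles (M : nmodType) (S : set M) : set M :=
  [set p | [/\ S p, p <> 0%R & ~ atoms S p]].

Definition column (S : set (nat * nat)) (x : nat) : set (nat * nat) :=
  [set p | [/\ S p, p.1 = x & 1 <= p.2]].

(* Main.v *)
(** A decomposition (x, n) = (a, m) + (b, k) in the Leamer monoid has m, k >= 1,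
    and a, b <> 0 because s is not in G.  If n > 2 then one of the two
    progressions, say the one at a, has m >= 2; dropping its last (resp. first)
    term decomposes (x, n - 1) (resp. (x + s, n - 1)), which gives (d) and (e).
    For (b), both summands of (xf, n) lie in finite columns left of xf, whose
    heights have a common bound.  For (g), subtract (x0, 1). *)

Require Import Defs.
From HB Require Import structures.
From mathcomp Require Import all_boot all_order all_algebra.
From mathcomp Require Import boolp classical_sets functions cardinality.
From mathcomp Require Import zify.

Set Implicit Arguments.
Unset Strict Implicit.
Unset Printing Implicit Defensive.

(** The condition that defines [leamer] away from the origin, freed from [1 <= n], so that
    truncating and shifting carry no side condition. *)
Definition progression_in (G : set nat) (s x n : nat) : Prop :=
  forall i, i <= n -> G (x + i * s).

Lemma progression_in_le (G : set nat) (s x m n : nat) :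
  m <= n -> progression_in G s x n -> progression_in G s x m.
Proof. by move=> mn Gx i im; apply: Gx; apply: leq_trans im mn. Qed.

Lemma progression_in_shift (G : set nat) (s x n : nat) :
  progression_in G s x n.+1 -> progression_in G s (x + s) n.
Proof. by move=> Gx i i_n; rewrite -addnA -mulSn; apply: Gx. Qed.

Lemma progression_in_gt_frobenius (G : set nat) (s F x n : nat) :
  is_frobenius G F -> F < x -> progression_in G s x n.
Proof.
move=> [_ maxF] Fx i _; apply: contrapT => /maxF.
by rewrite leqNgt (leq_trans Fx) ?leq_addr.
Qed.

Lemma leamerE (G : set nat) (s x n : nat) :
  0 < n -> leamer G s (x, n) <-> progression_in G s x n.
Proof.
move=> n0; split=> [[[_ n00]|[]]//|Gx]; first by rewrite n00 in n0.
by right; split.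
Qed.

Lemma leamer_neq0 (G : set nat) (s : nat) (p : nat * nat) :
  leamer G s p -> p <> 0%R -> 0 < p.2 /\ progression_in G s p.1 p.2.
Proof. by move=> [|//] ->. Qed.

Lemma pair_neq0 (x n : nat) : 0 < n -> (x, n) <> 0%R :> nat * nat.
Proof. by move=> n0 [_ n00]; rewrite n00 in n0. Qed.

(** Every element other than the origin has positive height, so for the summands being nonzero
    amounts to [0 < m] and [0 < k], which arithmetic can handle. *)
Lemma decomposable_leamerP (G : set nat) (s x n : nat) :
  decomposable (leamer G s) (x, n) <->
  exists a m b k, [/\ 0 < m, 0 < k, x = a + b, n = m + k
    & progression_in G s a m /\ progression_in G s b k].
Proof.
split=> [[[a m] [[b k] [Sa Sb a0 b0 [-> ->]]]]|].
  have [/= m0 Ga] := leamer_neq0 Sa a0; have [/= k0 Gb] := leamer_neq0 Sb b0.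
  by exists a, m, b, k.
move=> [a [m [b [k [m0 k0 -> -> [Ga Gb]]]]]]; exists (a, m), (b, k).
by split=> //; [exact/leamerE|exact/leamerE|exact: pair_neq0|exact: pair_neq0].
Qed.

Lemma atoms_leamerP (G : set nat) (s x n : nat) : 0 < n ->
  atoms (leamer G s) (x, n) <->
  progression_in G s x n /\ ~ decomposable (leamer G s) (x, n).
Proof.
move=> n0; split=> [[/leamerE Gx _ nd]|[Gx nd]]; first by split=> //; exact: Gx.
by split=> //; [exact/leamerE|exact: pair_neq0].
Qed.

Lemma decomposable_leamer_pred (G : set nat) (s x n : nat) : 1 < n ->
  decomposable (leamer G s) (x, n.+1) -> decomposable (leamer G s) (x, n).
Proof.
move=> n1 /decomposable_leamerP[a [m [b [k [m0 k0 -> nE [Ga Gb]]]]]].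
apply/decomposable_leamerP; have [m1|m1] := leqP 2 m.
  exists a, m.-1, b, k; split; [lia..|split=> //].
  exact: progression_in_le (leq_pred _) Ga.
(* Here [m = 1], so [k = n >= 2] and the shortened height [k.-1] stays positive. *)
exists a, m, b, k.-1; split; [lia..|split=> //].
exact: progression_in_le (leq_pred _) Gb.
Qed.

Lemma decomposable_leamer_shift (G : set nat) (s x n : nat) : 1 < n ->
  decomposable (leamer G s) (x, n.+1) -> decomposable (leamer G s) (x + s, n).
Proof.
move=> n1 /decomposable_leamerP[a [m [b [k [m0 k0 -> nE [Ga Gb]]]]]].
apply/decomposable_leamerP; have [m1|m1] := leqP 2 m.
  exists (a + s), m.-1, b, k; split; [lia..|split=> //].
  by apply: progression_in_shift; rewrite prednK.
exists a, m, (b + s), k.-1; split; [lia..|split=> //].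
by apply: progression_in_shift; rewrite prednK.
Qed.

(** Columns are closed downwards, so one missing height bounds a whole column; finitely many such
    bounds have a maximum. *)
Lemma finite_columns_bounded (G : set nat) (s y : nat) :
  (forall a, a < y -> exists n, ~ progression_in G s a n) ->
  exists N, forall a n, a < y -> progression_in G s a n -> n < N.
Proof.
elim: y => [_|y IHy finy]; first by exists 0.
have [N HN] := IHy (fun a ay => finy a (ltnW ay)).
have [M HM] := finy y (ltnSn y).
exists (maxn N M) => a n; rewrite ltnS leq_eqVlt leq_max => /predU1P[->|ay] Ga.
  have [Mn|_] := leqP M n; last by rewrite orbT.
  by case: HM; exact: progression_in_le Ga.
by rewrite (HN a).
Qed.

Lemma atoms_leamer_first_infinite_column (G : set nat) (s xf : nat) : ~ G s ->
  is_smallest (fun x => forall n, 1 <= n -> leamer G s (x, n)) xf ->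
  exists N, forall n, N <= n -> atoms (leamer G s) (xf, n).
Proof.
move=> nGs [Sxf minxf].
have [a axf|N HN] := @finite_columns_bounded G s xf.
  (* A column left of [xf] that attained every height would contradict the minimality of [xf]. *)
  apply: contrapT => /forallNP nG; suff: xf <= a by rewrite leqNgt axf.
  by apply: minxf => n n1; apply/leamerE => //; apply: contrapT; apply: nG.
(* At [a = 0] the term of index 1 is [s], which lies outside [G]. Hence both summands start at
   positive positions, so strictly left of [xf]. *)
have gt0 a n : 0 < n -> progression_in G s a n -> 0 < a.
  by case: a => // n0 /(_ 1 n0); rewrite mul1n.
(* Two heights below [N] cannot add up to [N + N] or more; the successor keeps [n] positive even
   when [N = 0]. *)
exists (N + N).+1 => n Nn; have n0 : 0 < n by lia.
apply/atoms_leamerP => //; split; first exact/leamerE/Sxf.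
move=> /decomposable_leamerP[a [m [b [k [m0 k0 xE nE [Ga Gb]]]]]].
have a0 := gt0 _ _ m0 Ga; have b0 := gt0 _ _ k0 Gb.
have mN : m < N by apply: (HN a) => //; lia.
have kN : k < N by apply: (HN b) => //; lia.
lia.
Qed.

Lemma infinite_column_gt_frobenius (G : set nat) (s F x : nat) :
  is_frobenius G F -> F < x -> infinite_set (column (leamer G s) x).
Proof.
move=> hF Fx fin; apply: infinite_nat.
(* This map is injective and lands in the column, which starts at height 1; a finite column would
   thus have all of [nat] as a finite preimage. *)
pose f n := (x, n.+1).
apply: (@sub_finite_set _ _ (f @^-1` column (leamer G s) x)%classic).
  move=> n _; split=> //; apply/leamerE => //.
  exact: progression_in_gt_frobenius hF Fx.
by apply: finite_preimage fin => m n _ _ [].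
Qed.

Theorem lemma2p8 (G : set nat) (s F x0 xf : nat)
  (hG : numerical_monoid G)
  (hs : ~ G s)
  (hF : is_frobenius G F)
  (hx0 : is_smallest (fun x => leamer G s (x, 1)) x0)
  (hxf : is_smallest (fun x => forall n, 1 <= n -> leamer G s (x, n)) xf) :
  (* (a) *)
  (forall x : nat, leamer G s (x, 1) -> atoms (leamer G s) (x, 1)) /\
  (* (b) *)
  (exists N : nat, forall n : nat, N <= n -> atoms (leamer G s) (xf, n)) /\
  (* (c) *)
  (forall x n : nat, leamer G s (x, n) ->
     forall n', 1 <= n' -> n' <= n -> leamer G s (x, n')) /\
  (* (d) *)
  (forall x n : nat, 2 < n -> atoms (leamer G s) (x, n - 1) ->
     leamer G s (x, n) -> atoms (leamer G s) (x, n)) /\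
  (* (e); s <= x makes x - s a genuine difference *)
  (forall x n : nat, 2 < n -> s <= x -> atoms (leamer G s) (x, n - 1) ->
     leamer G s (x - s, n) -> atoms (leamer G s) (x - s, n)) /\
  (* (f) *)
  (forall x : nat, F < x -> infinite_set (column (leamer G s) x)) /\
  (* (g) *)
  (forall x n : nat, F + x0 < x -> 2 <= n -> reducibles (leamer G s) (x, n)).
Proof.
split.
  move=> x /leamerE Sx; apply/atoms_leamerP => //; split; first exact: Sx.
  (* Two positive heights cannot sum to 1. *)
  by move=> /decomposable_leamerP[a [m [b [k []]]]]; lia.
split; first exact: atoms_leamer_first_infinite_column.
split.
  move=> x n Sx n' n'1 n'n; have n0 := leq_trans n'1 n'n.
  by apply/leamerE => //; apply: progression_in_le n'n _; apply/leamerE.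
split.
  move=> x [//|n] n2; rewrite subn1 => /atoms_leamerP[|_ nd /leamerE Sx].
    exact: ltnW.
  apply/atoms_leamerP => //; split; first exact: Sx.
  by move=> /decomposable_leamer_pred-/(_ n2).
split.
  move=> x [//|n] n2 sx; rewrite subn1 => /atoms_leamerP[|_ nd /leamerE Sx].
    exact: ltnW.
  apply/atoms_leamerP => //; split; first exact: Sx.
  (* The bound [s <= x] turns the shifted position [x - s + s] back into [x]. *)
  by move=> /decomposable_leamer_shift-/(_ n2); rewrite subnK.
split; first by move=> x; exact: infinite_column_gt_frobenius.
move=> x n Fx n2; have n0 := ltnW n2; have [Sx0 _] := hx0.
have inG y k : F < y -> progression_in G s y k.
  exact: progression_in_gt_frobenius.
split; [|exact: pair_neq0|move=> /(atoms_leamerP _ _ _ n0)[_]; apply].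
  by apply/leamerE => //; apply: inG; lia.
(* Since [x - x0] still exceeds [F], its column contains the remaining height [n.-1], which is
   positive because [n >= 2]. *)
apply/decomposable_leamerP; exists x0, 1, (x - x0), n.-1.
by split; [lia..|split; [exact/leamerE|apply: inG; lia]].
Qed.
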